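(* Let $r\ge 2$ and $s\ge 1$ be integers, and for $n\ge 0$ let $h_n$ be the total number of occurrences of $r\times s$ rectangles over all Catalan words of length $n$. Then $$\sum_{n\ge 0}h_nx^n=\left(\left.\frac{\partial}{\partial t}P(x,t)\right|_{t=1}\right)(C(x)-1)^{r-1}.$$ In particular, $$h_n=\sum_{k=r}^{n+1-s}\frac{r-1}{k+r-2}\binom{2k-3}{k-r}\left(\sum_{i=0}^{s-2}\frac{s-1-i}{i+1}\binom{2i}{i}\binom{2(n+1-k)-2i}{n+1-k-i}-(2s-1)\binom{2(n+1-k)}{n+1-k}+4^{n+1-k}\right).$$
   Context: For a word $w=w_1\cdots w_n$ of positive integers, its bargraph consists of $n$ consecutive columns of unit cells, aligned at the bottom, the $i$-th column having height $w_i$. For integers $\rho,s\ge1$, an occurrence of a $\rho\times s$ rectangle in $w$ is a placement of a rectangle of height $\rho$ and width $s$ (with sides along the unit grid) inside the bargraph. Equivalently, the number of occurrences is $\sum_{i=1}^{n-s+1}\max\{\min\{w_i,\ldots,w_{i+s-1}\}-\rho+1,0\}$ (which is $0$ if $n<s$). The total number over a set of words is the sum of these numbers over all words in the set. A Catalan word of length $n$ is a word $w_1\cdots w_n$ of positive integers with $w_1=1$ and $w_{i+1}\le w_i+1$ for all $1\le i\le n-1$; $\mathcal{C}_n$ is the set of Catalan words of length $n$ ($\mathcal{C}_0$ contains only the empty word). Let $p_n(t)=\sum_{w\in\mathcal{C}_n}t^{(\text{number of occurrences of } 1\times s\text{ rectangles in } w)}$ and $P(x,t)=\sum_{n\ge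 0}p_n(t)x^n$ (formal power series in $x$ with coefficients polynomials in $t$). $C(x)=\sum_{n\ge 0}\frac{1}{n+1}\binom{2n}{n}x^n$ is the generating function of the Catalan numbers. Empty sums are $0$. *)

(* Defs.v *)
From mathcomp Require Import all_boot all_order all_algebra.

Set Implicit Arguments.
Unset Strict Implicit.
Unset Printing Implicit Defensive.

Import Order.TTheory GRing.Theory Num.Theory.

Definition catalan (w : seq nat) : bool :=
  all (leq 1) w &&
  (if w is x :: w' then (x == 1) && path (fun a b => b <= a.+1) x w' else true).

(* The letters of a Catalan word of length n are at most n, so it suffices to
   filter the words over {0, ..., n}; see mem_catalan_words. *)
Definition catalan_words (n : nat) : seq (seq nat) :=
  [seq w <- [seq map val t | t : n.-tuple 'I_n.+1] | catalan w].

Lemma catalan_path_bound x w :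
  path (fun a b => b <= a.+1) x w -> all (geq (x + size w)) w.
Proof.
elim: w x => //= y w IH x /andP[yx /IH Hw].
apply/andP; split; first by rewrite addnS; apply: leq_trans yx _; rewrite ltnS leq_addr.
apply: sub_all Hw => z /= zy; apply: leq_trans zy _.
by rewrite addnS -addSn leq_add2r.
Qed.

Lemma catalan_bound w : catalan w -> all (geq (size w)) w.
Proof.
case: w => //= x w /andP[_ /andP[/eqP-> /catalan_path_bound]].
by rewrite add1n => ->.
Qed.

Lemma mem_catalan_words n w :
  (w \in catalan_words n) = (size w == n) && catalan w.
Proof.
rewrite mem_filter andbC; case Cw: (catalan w); rewrite ?andbF ?andbT //.
apply/idP/idP => [/mapP[t _ ->]|/eqP sw]; first by rewrite size_map size_tuple.
have Hs : size (map (@inord n) w) == n by rewrite size_map sw.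
apply/mapP; exists (Tuple Hs); first by rewrite mem_enum.
rewrite /= -map_comp -[LHS]map_id; apply/eq_in_map => x xw /=.
by rewrite inordK // ltnS -sw; apply: (allP (catalan_bound Cw)).
Qed.

Lemma catalan_words_uniq n : uniq (catalan_words n).
Proof.
apply: filter_uniq; rewrite map_inj_uniq ?enum_uniq // => t u.
by move/(inj_map val_inj)/val_inj.
Qed.

(* Columns and rows are numbered from 0; the default 0 of nth makes every
   column beyond the last one empty. *)
Definition cell (w : seq nat) (x y : nat) : bool := y < nth 0 w x.

Definition rectangle_at (rho s : nat) (w : seq nat) (i j : nat) : bool :=
  [forall a : 'I_s, forall b : 'I_rho, cell w (i + a) (j + b)].

(* For rho, s >= 1 the lower left cell (i, j) of a placement lies in the
   bargraph, so i < size w and j < \max_(x <- w) x lose no placement. *)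
Definition occ (rho s : nat) (w : seq nat) : nat :=
  \sum_(i < size w) \sum_(j < \max_(x <- w) x) rectangle_at rho s w i j.

Lemma rectangle_atE rho s w i j : 0 < rho -> 0 < s ->
  rectangle_at rho s w i j =
  (j < (\big[minn/nth 0 w i]_(i <= k < i + s) nth 0 w k).+1 - rho).
Proof.
move=> rho0 s0; rewrite ltn_subRL ltnS.
apply/idP/idP => [H | H].
  have Hk k : i <= k < i + s -> rho + j <= nth 0 w k.
    move=> /andP[ik kis].
    have ks : k - i < s by rewrite ltn_subLR.
    have rr : rho.-1 < rho by rewrite prednK.
    have /forallP/(_ (Ordinal rr)) := forallP H (Ordinal ks).
    by rewrite /cell /= subnKC // -addnS prednK // addnC.
  rewrite big_seq_cond.
  apply: (big_ind (fun m => rho + j <= m)) => [|x y Hx Hy|k].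
  - by apply: Hk; rewrite leqnn -{1}[i]addn0 ltn_add2l.
  - by rewrite leq_min Hx.
  - by rewrite andbT mem_index_iota => /Hk.
apply/forallP => a; apply/forallP => b; rewrite /cell.
have Hm : \big[minn/nth 0 w i]_(i <= k < i + s) nth 0 w k <= nth 0 w (i + a).
  have : i + a \in index_iota i (i + s).
    by rewrite mem_index_iota leq_addr ltn_add2l /=.
  elim: (index_iota _ _) => //= k l IH; rewrite inE big_cons geq_min.
  by case/orP => [/eqP->|/IH->]; rewrite ?leqnn ?orbT.
apply: leq_trans Hm; apply: leq_trans H.
by rewrite addnC -addSn leq_add2r.
Qed.

Lemma occE rho s w : 0 < rho -> 0 < s ->
  occ rho s w =
  \sum_(0 <= i < (size w).+1 - s)
    ((\big[minn/nth 0 w i]_(i <= k < i + s) nth 0 w k).+1 - rho).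
Proof.
move=> rho0 s0; pose M i := (\big[minn/nth 0 w i]_(i <= k < i + s) nth 0 w k).+1 - rho.
have Mlow i : M i <= nth 0 w i.
  rewrite leq_subLR -[X in X <= _]addn1 addnC leq_add //.
  elim: (index_iota _ _) => [|k l IH]; first by rewrite big_nil.
  by rewrite big_cons geq_min IH orbT.
have maxP i : nth 0 w i <= \max_(x <- w) x.
  case: (ltnP i (size w)) => Hi; last by rewrite nth_default.
  by apply: leq_bigmax_seq; rewrite ?mem_nth.
have inner i : \sum_(j < \max_(x <- w) x) rectangle_at rho s w i j = M i.
  rewrite (eq_bigr (fun j : 'I__ => nat_of_bool (j < M i))); last first.
    by move=> j _; rewrite rectangle_atE.
  rewrite -(big_mkord xpredT (fun j => nat_of_bool (j < M i))).
  rewrite (big_cat_nat (n := M i)) //=; last exact: leq_trans (Mlow i) _.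
  rewrite [X in _ + X]big_nat_cond [X in _ + X]big1 ?addn0; last first.
    by move=> j /andP[/andP[Hj _] _]; rewrite ltnNge Hj.
  rewrite big_nat_cond (eq_bigr (fun=> 1)); last first.
    by move=> j /andP[/andP[_ ->] _].
  by rewrite -big_nat_cond sum_nat_const_nat muln1 subn0.
rewrite /occ (eq_bigr (fun i : 'I__ => M i)) => [|i _]; last exact: inner.
rewrite -(big_mkord xpredT M).
have Hle : (size w).+1 - s <= size w by rewrite leq_subLR -[s]prednK // addSn ltnS leq_addl.
rewrite (big_cat_nat (n := (size w).+1 - s)) //= [X in _ + X]big_nat_cond.
rewrite [X in _ + X]big1 ?addn0 // => i /andP[/andP[Hi _] _].
apply/eqP; rewrite -leqn0 /M leq_subLR addn0.
apply: leq_trans rho0; rewrite ltnS.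
have Hlast : nth 0 w (i + s.-1) = 0.
  rewrite nth_default //; move: Hi; rewrite leq_subLR -{1}[s]prednK //.
  by rewrite addSn ltnS addnC.
have : i + s.-1 \in index_iota i (i + s).
  by rewrite mem_index_iota leq_addr ltn_add2l prednK /=.
elim: (index_iota _ _) => //= k l IH; rewrite inE big_cons geq_min.
by case/orP => [/eqP<-|/IH->]; rewrite ?Hlast ?orbT.
Qed.

Definition total_occ (rho s n : nat) : nat :=
  \sum_(w <- catalan_words n) occ rho s w.

Local Open Scope ring_scope.

(* A formal power series is the sequence of its coefficients. *)
Definition fps (R : Type) : Type := nat -> R.

Definition fps_one {R : nzRingType} : fps R := fun n => (n == 0%N)%:R.

Definition fps_sub {R : nzRingType} (f g : fps R) : fps R :=
  fun n => f n - g n.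

Definition fps_mul {R : nzRingType} (f g : fps R) : fps R :=
  fun n => \sum_(i < n.+1) f i * g (n - i)%N.

Definition fps_exp {R : nzRingType} (f : fps R) (m : nat) : fps R :=
  iter m (fps_mul f) fps_one.

Definition p_poly (s n : nat) : {poly rat} :=
  \sum_(w <- catalan_words n) 'X ^+ occ 1 s w.

Definition P_gf (s : nat) : fps {poly rat} := fun n => p_poly s n.

(* The partial derivative with respect to the variable of the coefficient
   polynomials; the variable of the series is untouched. *)
Definition fps_dt {R : nzRingType} (F : fps {poly R}) : fps {poly R} :=
  fun n => (F n)^`().

Definition fps_eval_t {R : nzRingType} (F : fps {poly R}) (a : R) : fps R :=
  fun n => (F n).[a].

Definition C_gf : fps rat := fun n => 1 / n.+1%:R * 'C(2 * n, n)%:R.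

Definition h_gf (r s : nat) : fps rat := fun n => (total_occ r s n)%:R.

(* Main.v *)
From HB Require Import structures.
Require Import Defs.
From mathcomp Require Import all_boot all_order all_algebra.
From mathcomp Require boolp.
From mathcomp Require Import ring zify.

(** A nonempty Catalan word is uniquely [1 (u+1) v] with [u] and [v] Catalan
    words ([u+1] raises every letter by one, and [v] starts at the first return
    to height 1).  A window of width [s] in which every column has height at
    least [r+1 >= 2] avoids the letters equal to 1, so it lies inside [u+1] or
    inside [v], and in the first case it is a window of [u] with columns of
    height at least [r].  Writing [H_r] for the generating function of the
    [r x s] rectangles and [C] for that of the Catalan words, this gives
    (lemma [h_gf_arch])
      [H_(r+1) = x (H_r C + C H_(r+1))], that is, [H_(r+1) = (C - 1) H_r]
    because [C = 1 + x C^2].  Hence [H_r = H_1 (C - 1)^(r-1)], and [H_1] is the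
    derivative of [P] at [t = 1].

    For the coefficients, every one of the [n+1-s] windows of a word of length
    [n >= s] contains exactly one rectangle of height 1 resting on the ground,
    and extending each of the others down by one row gives every rectangle of
    height 2 once.  So
      [H_1 = D + H_2 = D + (C - 1) H_1], with [D] the series of [(n+1-s)^+ C_n].
    Let [B] be the series of the central binomial coefficients.  From
    [B (1 - 2 x C) = 1] one gets [(2 - C) (1 + B) = 2], so
    [2 H_1 = D (1 + B)]; since [D = B - s C + S], where [S] is the polynomial
    with coefficients [(s-1-n)^+ C_n], and [C (1 + B) = 2 B],
      [2 H_1 = B^2 - (2 s - 1) B + S (1 + B)]
    (lemma [h_gf1]).  Here [B^2 = 1 / (1 - 4 x)] supplies the powers of 4.
    Finally [Z = C - 1] satisfies [Z = x (1 + Z)^2], so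
    [Z^(m+1) = x (Z^m + 2 Z^(m+1) + Z^(m+2))]; differences of binomial
    coefficients satisfy the same recurrence by Pascal's rule applied twice,
    and so they are the coefficients of [Z^m] (lemma [catalan_sub1_expS]). *)

Import GRing.Theory Num.Theory.

(** * Occurrences of a rectangle, one column at a time *)

(** As columns beyond the last one are empty, this is 0 when the window does not
    fit into the word. *)
Definition window_min (s : nat) (w : seq nat) : nat :=
  \big[minn/nth 0 w 0]_(0 <= k < s) nth 0 w k.

(** The disjunct [t == 0] accounts for windows that stick out of the word. *)
Lemma leq_window_min s w t : 0 < s ->
  (t <= window_min s w) = (all (leq t) (take s w) && ((s <= size w) || (t == 0))).
Proof.
move=> s0; have -> : (t <= window_min s w) = [forall k : 'I_s, t <= nth 0 w k].
  rewrite /window_min big_mkord; apply/idP/forallP => [H k|H].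
    apply: leq_trans H _; rewrite -(big_mkord xpredT (fun i => nth 0 w i)).
    have : val k \in index_iota 0 s by rewrite mem_index_iota /=.
    elim: (index_iota _ _) => //= i l IH; rewrite inE big_cons geq_min.
    by case/orP => [/eqP<-|/IH->]; rewrite ?leqnn ?orbT.
  elim/big_ind: _ => [|a b Ha Hb|k _]; last exact: H.
    exact: (H (Ordinal s0)).
  by rewrite leq_min Ha.
apply/forallP/andP => [H|[/(all_nthP 0) H /orP[sw|/eqP->//] k]].
  split.
    apply/(all_nthP 0) => i; rewrite size_take_min leq_min => /andP[i_s _].
    by rewrite nth_take //; apply: (H (Ordinal i_s)).
  case: leqP => //= sw; have := H (Ordinal (leq_trans sw (leqnn s))).
  by rewrite nth_default // leqn0.
have := H k; rewrite size_take_min leq_min ltn_ord (leq_trans (ltn_ord k) sw).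
by rewrite nth_take //; apply.
Qed.

Lemma window_min_le_head s a w : 0 < s -> window_min s (a :: w) <= a.
Proof.
case: s => // s s0; have := leq_window_min _ (a :: w) (window_min s.+1 (a :: w)) s0.
by rewrite leqnn => /esym /andP[/andP[]].
Qed.

Lemma occ_nil rho s : occ rho s [::] = 0.
Proof. by rewrite /occ big_ord0. Qed.

Lemma occ_cons rho s a w : 0 < rho -> 0 < s ->
  occ rho s (a :: w) = (window_min s (a :: w)).+1 - rho + occ rho s w.
Proof.
move=> rho0 s0; rewrite !occE //=; case: (leqP s (size w).+1) => sw.
  rewrite subSn // big_nat_recl // add0n; congr (_ + _).
  apply: eq_bigr => i _; congr (_.+1 - rho).
  by rewrite addSn big_add1.
have /eqP -> : (size w).+2 - s == 0 by rewrite subn_eq0.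
have /eqP -> : (size w).+1 - s == 0 by rewrite subn_eq0 ltnW.
rewrite !big_geq // addn0; apply/esym/eqP; rewrite subn_eq0.
apply: leq_ltn_trans rho0.
have := leq_window_min s (a :: w) (window_min s (a :: w)) s0.
by rewrite leqnn /= [s <= _]leqNgt sw => /esym /andP[_ /eqP ->].
Qed.

(** A window that fits has a positive minimum, hence exactly one rectangle of
    height 1 on the ground; extending each higher one down by one row gives a
    bijection with the rectangles of height 2. *)
Lemma occ_row1 s w : 0 < s -> all (leq 1) w ->
  occ 1 s w = ((size w).+1 - s) + occ 2 s w.
Proof.
move=> s0; elim: w => [|a w IH] /=.
  by rewrite !occ_nil => _; rewrite addn0; apply/esym/eqP; rewrite subn_eq0.
move=> /andP[a1 w1]; rewrite !occ_cons // IH //.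
have := leq_window_min s (a :: w) 1 s0; rewrite orbF.
have -> : all (leq 1) (take s (a :: w)).
  by apply/allP => y /mem_take; apply: (allP (_ : all (leq 1) (a :: w))); rewrite /= a1.
by rewrite andTb /=; lia.
Qed.

(** A window that starts in the lifted part and leaves it meets the first letter
    of [v], which is at most 1, or the end of the word; so it is too low to
    contain a rectangle of height [r+1 >= 2]. *)
Lemma occ_lift r s u v : 0 < r -> 0 < s -> head 0 v <= 1 ->
  occ r.+1 s (map succn u ++ v) = occ r s u + occ r.+1 s v.
Proof.
move=> r0 s0 v1; elim: u => [|a u IH]; first by rewrite occ_nil.
rewrite map_cons cat_cons !occ_cons // IH addnA; congr (_ + _).
have E t : r <= t ->
  (t.+1 <= window_min s (map succn (a :: u) ++ v)) = (t <= window_min s (a :: u)).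
  move=> rt; rewrite !leq_window_min // size_cat size_map orbF.
  have t0 : 0 < t by apply: leq_trans rt.
  rewrite -[t == 0]negbK -lt0n t0 orbF take_cat size_map.
  case: ltnP => su.
    by rewrite (ltnW su) -map_take all_map (leq_trans (ltnW su) (leq_addr _ _)).
  rewrite all_cat all_map [in RHS]take_oversize //.
  case: (eqVneq s (size (a :: u))) => [->|nsu].
    by rewrite subnn take0 leqnn leq_addr !andbT.
  have us : (size (a :: u) < s) by rewrite ltn_neqAle eq_sym nsu.
  rewrite [s <= size (a :: u)]leqNgt us andbF.
  case: v v1 {IH} => [|b v] /= b1.
    by move: us => /= us; rewrite addn0 [s <= _]leqNgt us andbF.
  have -> : s - (size u).+1 = (s - (size u).+2).+1 by move: us => /=; lia.
  by rewrite /= [t < b](_ : _ = false) ?andbF //; lia.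
(* The values [t = m] and [t = m' - 1] of E compare the two minima in both
   directions; [t = r] settles the case where no rectangle fits. *)
set m' := window_min s (_ :: _ ++ _) in E *; set m := window_min s _ in E *.
have := E r (leqnn _); have := E m; have := E m'.-1; lia.
Qed.

Lemma occ_arch r s u v : 0 < r -> 0 < s -> head 0 v <= 1 ->
  occ r.+1 s (1 :: map succn u ++ v) = occ r s u + occ r.+1 s v.
Proof.
move=> r0 s0 v1; rewrite occ_cons // occ_lift //.
have := window_min_le_head s 1 (map succn u ++ v) s0; lia.
Qed.

(** * First return decomposition of Catalan words *)

Definition arch (uv : seq nat * seq nat) : seq nat := 1 :: map succn uv.1 ++ uv.2.

Lemma catalan_head v : catalan v -> head 0 v <= 1.
Proof. by case: v => //= a v /andP[_ /andP[/eqP->]]. Qed.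

Lemma catalan_arch u v : catalan u -> catalan v -> catalan (arch (u, v)).
Proof.
move=> cu cv; have v1 := catalan_head _ cv; move: cu cv => /andP[u1 pu] /andP[va pv].
apply/andP; rewrite /arch /= all_cat all_map va cat_path.
split; first by rewrite andbT; apply/allP.
apply/andP; split.
  by case: u pu {u1} => //= a u /andP[/eqP-> pu]; rewrite path_map.
by case: v v1 pv {va} => //= a v v1 /andP[_ ->]; rewrite (leq_trans v1).
Qed.

(** The cut is at the first letter equal to 1 after the initial one. *)
Lemma catalan_archP w : catalan w -> w != [::] ->
  exists2 uv, catalan uv.1 && catalan uv.2 & w = arch uv.
Proof.
case: w => //= a w /andP[/= /andP[_ w1] /andP[/eqP-> pw]] _.
pose i := find (leq^~ 1) w.
exists (map predn (take i w), drop i w) => /=; last first.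
  rewrite /arch /= -map_comp -[w in LHS](cat_take_drop i w); congr (_ :: _ ++ _).
  rewrite -[LHS]map_id; apply/eq_in_map => y /mem_take yw /=.
  by rewrite prednK //; apply: (allP w1).
have ti : all (leq 2) (take i w).
  apply/(all_nthP 0) => k; rewrite size_take_min leq_min => /andP[ki kw].
  by rewrite nth_take // ltnNge; rewrite (before_find 0 ki).
move: pw; rewrite -{1}(cat_take_drop i w) cat_path => /andP[pt pd].
apply/andP; split; apply/andP; split.
- by rewrite all_map; apply: sub_all ti => y /=; case: y.
- case: (take i w) ti pt => //= b t /andP[b2 t2] /andP[b1 pt]; apply/andP; split.
    by move: b1 b2; case: b pt => [|[|[|]]].
  rewrite path_map; move: pt; apply: (@sub_in_path _ (leq 2)) => [x y|]; last first.
    by rewrite /= b2 t2.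
  by rewrite -!topredE /=; case: x => // x _; case: y.
- by apply/allP => y /mem_drop; apply: (allP w1).
case Ed: (drop i w) pd => [|b d] //= /andP[_ ->]; rewrite andbT.
have iw : i < size w by rewrite ltnNge; apply/negP => /drop_oversize; rewrite Ed.
have : b = nth 0 w i by rewrite -[i]addn0 -nth_drop Ed.
have : nth 0 w i <= 1 by apply: (@nth_find _ 0 (leq^~ 1)); rewrite has_find.
have := allP w1 _ (mem_nth 0 iw) => /=.
by move=> h1 h2 ->; rewrite eqn_leq h1 h2.
Qed.

(** All letters of the lifted part are at least 2, so its length can be read off
    as the position of the first letter that is at most 1. *)
Lemma arch_inj u v u' v' : catalan u -> catalan u' -> catalan v -> catalan v' ->
  arch (u, v) = arch (u', v') -> (u, v) = (u', v').
Proof.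
have take_arch a b : catalan a -> catalan b ->
    find (leq^~ 1) (map succn a ++ b) = size a.
  move=> /andP[a1 _] /catalan_head b1; rewrite find_cat size_map.
  rewrite has_map (negPf (_ : ~~ has _ _)).
    by case: b b1 => [|c b] /= c1; rewrite ?c1 addn0.
  by rewrite -all_predC; apply: sub_all a1 => y /=; rewrite -ltnNge ltnS.
move=> cu cu' cv cv' [E].
have Es : size u = size u' by rewrite -(take_arch u v) // E take_arch.
move/eqP: E; rewrite eqseq_cat ?size_map // => /andP[/eqP Eu /eqP->].
by rewrite (inj_map succn_inj Eu).
Qed.

Lemma catalan_words_perm n :
  perm_eq (catalan_words n.+1)
    [seq arch uv | i <- iota 0 n.+1,
       uv <- [seq (u, v) | u <- catalan_words i, v <- catalan_words (n - i)]].
Proof.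
have wordsP i u : u \in catalan_words i -> size u = i /\ catalan u.
  by rewrite mem_catalan_words => /andP[/eqP-> ->].
apply: uniq_perm; first exact: catalan_words_uniq.
  apply: allpairs_uniq_dep; first exact: iota_uniq.
    move=> i _; apply: allpairs_uniq; try exact: catalan_words_uniq.
    by move=> [? ?] [? ?].
  move=> p q /allpairsPdep[i [uv [_ uvi ->]]] /allpairsPdep[j [uv' [_ uvj ->]]] /=.
  case/allpairsP: uvi => -[u v] [/wordsP[su cu] /wordsP[_ cv] ->].
  case/allpairsP: uvj => -[u' v'] [/wordsP[su' cu'] /wordsP[_ cv'] ->] /=.
  move/(arch_inj _ _ _ _ cu cu' cv cv') => [Eu Ev].
  by move: su' cu'; rewrite -Eu -Ev su => <-.
move=> w; rewrite mem_catalan_words; apply/andP/allpairsPdep.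
  move=> [/eqP sw cw]; have w0 : w != [::] by case: w sw {cw}.
  have [[u v] /= /andP[cu cv] Ew] := catalan_archP _ cw w0.
  have [su] : size u + size v = n.
    by move: sw; rewrite Ew /arch /= size_cat size_map => -[].
  exists (size u), (u, v); split; last exact: Ew.
    by rewrite -[_ :: _]/(iota 0 n.+1) mem_iota add0n ltnS -su leq_addr.
  by apply: allpairs_f; rewrite mem_catalan_words ?cu ?cv ?eqxx // -su addKn eqxx.
move=> [i [uv [i_n /allpairsP[[u v] [/wordsP[su cu] /wordsP[sv cv] ->]] ->]]].
split; last exact: catalan_arch.
move: i_n; rewrite mem_iota add0n => /andP[_ i_n].
by rewrite /arch /= size_cat size_map su sv subnKC.
Qed.

Lemma sum_catalan_words n (F : seq nat -> nat) :
  \sum_(w <- catalan_words n.+1) F w =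
  \sum_(i < n.+1) \sum_(u <- catalan_words i) \sum_(v <- catalan_words (n - i))
    F (arch (u, v)).
Proof.
rewrite (perm_big _ (catalan_words_perm n)) big_allpairs_dep.
rewrite -[iota 0 n.+1]/(index_iota 0 n.+1).
rewrite big_mkord; apply: eq_bigr => i _.
by rewrite big_allpairs_dep.
Qed.

Lemma catalan_words0 : catalan_words 0 = [:: [::]].
Proof.
apply: perm_small_eq => //; apply: uniq_perm; rewrite ?catalan_words_uniq // => w.
by rewrite mem_catalan_words inE; case: w.
Qed.

Lemma size_catalan_wordsS n : size (catalan_words n.+1) =
  \sum_(i < n.+1) size (catalan_words i) * size (catalan_words (n - i)).
Proof.
have sizeE (T : Type) (l : seq T) : size l = \sum_(z <- l) 1 by rewrite sum1_size.
rewrite sizeE sum_catalan_words; apply: eq_bigr => i _.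
under eq_bigr do rewrite sum1_size.
by rewrite big_const_seq count_predT iter_addn_0 mulnC.
Qed.

Lemma total_occS r s n : 0 < r -> 0 < s ->
  total_occ r.+1 s n.+1 =
  \sum_(i < n.+1) (total_occ r s i * size (catalan_words (n - i)) +
                   size (catalan_words i) * total_occ r.+1 s (n - i)).
Proof.
move=> r0 s0; rewrite /total_occ sum_catalan_words; apply: eq_bigr => i _.
under eq_bigr => u _.
  rewrite big_seq; under eq_bigr => v.
    rewrite mem_catalan_words => /andP[_ /catalan_head v1].
    rewrite occ_arch //; over.
  rewrite -big_seq big_split /= big_const_seq count_predT iter_addn_0; over.
rewrite big_split /= -big_distrl /=.
by rewrite big_const_seq count_predT iter_addn_0 [X in _ + X]mulnC.
Qed.

Lemma total_occ_row1 s n : 0 < s ->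
  total_occ 1 s n = (n.+1 - s) * size (catalan_words n) + total_occ 2 s n.
Proof.
move=> s0; rewrite /total_occ big_seq.
under eq_bigr => w.
  rewrite mem_catalan_words => /andP[/eqP sw /andP[w1 _]].
  rewrite occ_row1 // sw; over.
by rewrite -big_seq big_split /= big_const_seq count_predT iter_addn_0.
Qed.

Lemma total_occ0 rho s : total_occ rho s 0 = 0.
Proof. by rewrite /total_occ catalan_words0 big_seq1 occ_nil. Qed.

Lemma total_occ_small rho s n : 0 < rho -> n < s -> total_occ rho s n = 0.
Proof.
move=> rho0 ns; rewrite /total_occ big_seq big1 // => w.
rewrite mem_catalan_words => /andP[/eqP sw _].
by rewrite occE ?(leq_ltn_trans _ ns) // sw big_geq // leqn0 subn_eq0.
Qed.

(** * Formal power series as a commutative ring *)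

Local Open Scope ring_scope.

Definition fps_trunc {R : nzRingType} (N : nat) (f : fps R) : {poly R} :=
  \poly_(i < N) f i.

(** Each coefficient of a product of series is one of a product of polynomials,
    so that the laws of multiplication can be taken from polynomials. *)
Lemma fps_mul_truncE {R : nzRingType} (N n : nat) (f g : fps R) :
  (n < N)%N -> fps_mul f g n = (fps_trunc N f * fps_trunc N g)`_n.
Proof.
move=> nN; rewrite coefM; apply: eq_bigr => i _.
have iN : (i < N)%N by apply: leq_ltn_trans nN; rewrite -ltnS.
have niN : (n - i < N)%N by apply: leq_ltn_trans nN; rewrite leq_subr.
by rewrite !coef_poly iN niN.
Qed.

HB.instance Definition _ (R : comNzRingType) := boolp.gen_eqMixin (fps R).
HB.instance Definition _ (R : comNzRingType) := boolp.gen_choiceMixin (fps R).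

Definition fps_add {R : comNzRingType} (f g : fps R) : fps R := fun n => f n + g n.
Definition fps_opp {R : comNzRingType} (f : fps R) : fps R := fun n => - f n.
Definition fps_zero {R : comNzRingType} : fps R := fun=> 0.

Lemma fps_addA (R : comNzRingType) : associative (@fps_add R).
Proof. by move=> f g h; apply: boolp.funext => n; apply: addrA. Qed.

Lemma fps_addC (R : comNzRingType) : commutative (@fps_add R).
Proof. by move=> f g; apply: boolp.funext => n; apply: addrC. Qed.

Lemma fps_add0 (R : comNzRingType) : left_id fps_zero (@fps_add R).
Proof. by move=> f; apply: boolp.funext => n; apply: add0r. Qed.

Lemma fps_addN (R : comNzRingType) : left_inverse fps_zero fps_opp (@fps_add R).
Proof. by move=> f; apply: boolp.funext => n; apply: addNr. Qed.

HB.instance Definition _ (R : comNzRingType) :=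
  GRing.isZmodule.Build (fps R) (@fps_addA R) (@fps_addC R) (@fps_add0 R) (@fps_addN R).

Lemma fps_mulA (R : comNzRingType) : associative (@fps_mul R).
Proof.
move=> f g h; apply: boolp.funext => n.
have trunc_mul (u v : fps R) i : (i < n.+1)%N ->
    (fps_trunc n.+1 (fps_mul u v))`_i = (fps_trunc n.+1 u * fps_trunc n.+1 v)`_i.
  by move=> iN; rewrite coef_poly iN -fps_mul_truncE.
rewrite !(@fps_mul_truncE _ n.+1) //.
have -> : (fps_trunc n.+1 f * fps_trunc n.+1 (fps_mul g h))`_n =
          (fps_trunc n.+1 f * (fps_trunc n.+1 g * fps_trunc n.+1 h))`_n.
  by rewrite !coefM; apply: eq_bigr => i _; rewrite trunc_mul // ltnS leq_subr.
rewrite mulrA coefM [RHS]coefM.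
by apply: eq_bigr => i _; rewrite trunc_mul.
Qed.

Lemma fps_mulC (R : comNzRingType) : commutative (@fps_mul R).
Proof.
by move=> f g; apply: boolp.funext => n; rewrite !(@fps_mul_truncE _ n.+1) // mulrC.
Qed.

Lemma fps_mul1 (R : comNzRingType) : left_id fps_one (@fps_mul R).
Proof.
move=> f; apply: boolp.funext => n; rewrite /fps_mul /fps_one big_ord_recl /=.
by rewrite mul1r subn0 big1 ?addr0 // => i _; rewrite mul0r.
Qed.

Lemma fps_mulDl (R : comNzRingType) : left_distributive (@fps_mul R) (@fps_add R).
Proof.
move=> f g h; apply: boolp.funext => n; rewrite /fps_mul /fps_add -big_split /=.
by apply: eq_bigr => i _; rewrite mulrDl.
Qed.

Lemma fps_one_neq0 (R : comNzRingType) : (fps_one : fps R) != 0.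
Proof.
apply/eqP => /(congr1 (fun f : fps R => f 0%N)) /eqP.
by rewrite /fps_one eqxx (negPf (oner_neq0 R)).
Qed.

HB.instance Definition _ (R : comNzRingType) := GRing.Zmodule_isComNzRing.Build (fps R)
  (@fps_mulA R) (@fps_mulC R) (@fps_mul1 R) (@fps_mulDl R) (@fps_one_neq0 R).

Lemma fps_addE (R : comNzRingType) (f g : fps R) n : (f + g) n = f n + g n.
Proof. by []. Qed.

Lemma fps_oppE (R : comNzRingType) (f : fps R) n : (- f) n = - f n.
Proof. by []. Qed.

Lemma fps_oneE (R : comNzRingType) n : (1 : fps R) n = (n == 0%N)%:R.
Proof. by []. Qed.

Lemma fps_mulE (R : comNzRingType) (f g : fps R) n :
  (f * g) n = \sum_(i < n.+1) f i * g (n - i)%N.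
Proof. by []. Qed.

Lemma fps_mulrnE (R : comNzRingType) (f : fps R) k n : (f *+ k) n = f n *+ k.
Proof. by elim: k => // k IH; rewrite !mulrS fps_addE IH. Qed.

Lemma fps_expE (R : comNzRingType) (f : fps R) m : fps_exp f m = f ^+ m.
Proof. by elim: m => // m IH; rewrite exprS -IH. Qed.

Definition fps_X {R : comNzRingType} : fps R := fun n => (n == 1%N)%:R.

Lemma fps_mulX0 (R : comNzRingType) (f : fps R) : (fps_X * f) 0%N = 0.
Proof. by rewrite fps_mulE big_ord1 mul0r. Qed.

Lemma fps_mulXS (R : comNzRingType) (f : fps R) n : (fps_X * f) n.+1 = f n.
Proof.
rewrite fps_mulE 2!big_ord_recl big1 => [|i _]; last by rewrite mul0r.
by rewrite mul0r mul1r add0r addr0 /= subSS subn0.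
Qed.

Lemma fps_mulX_inj (R : comNzRingType) : injective (fun f : fps R => fps_X * f).
Proof.
move=> f g fg; apply: boolp.funext => n.
by rewrite -(fps_mulXS _ f) -(fps_mulXS _ g); congr (_ n.+1).
Qed.

(** The Euler operator, [x] times the derivative.  Unlike the derivative it does
    not shift the coefficients, which makes the product rule immediate. *)
Definition fps_theta {R : comNzRingType} (f : fps R) : fps R := fun n => f n *+ n.

Lemma fps_thetaM (R : comNzRingType) (f g : fps R) :
  fps_theta (f * g) = fps_theta f * g + f * fps_theta g.
Proof.
apply: boolp.funext => n; rewrite /fps_theta fps_addE !fps_mulE -sumrMnl -big_split.
apply: eq_bigr => i _ /=.
by rewrite mulrnAl mulrnAr -mulrnDr subnKC // -ltnS.
Qed.

(** The factor [x] makes each coefficient of the right-hand side depend only on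
    earlier coefficients. *)
Lemma fps_catalan_unique (R : comNzRingType) (f g : fps R) :
  f = 1 + fps_X * f ^+ 2 -> g = 1 + fps_X * g ^+ 2 -> f = g.
Proof.
move=> Ef Eg; apply: boolp.funext => n.
elim/ltn_ind: n => -[|n] IH; rewrite Ef Eg !fps_addE ?fps_mulX0 // !fps_mulXS.
congr (_ + _); rewrite !expr2 !fps_mulE; apply: eq_bigr => i _.
by rewrite !IH // ltnS ?leq_subr // -ltnS.
Qed.

(** * Catalan and central binomial series *)

Local Notation fpsX := (fps_X : fps rat).

Definition central_gf : fps rat := fun n => 'C(2 * n, n)%:R.

Lemma central_binS n : ('C(2 * n.+1, n.+1) * n.+1 = 2 * (2 * n).+1 * 'C(2 * n, n))%N.
Proof.
have -> : (2 * n.+1 = (2 * n).+2)%N by lia.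
rewrite binS.
have -> : 'C((2 * n).+1, n) = 'C((2 * n).+1, n.+1).
  by rewrite -bin_sub; [congr 'C(_, _)|]; lia.
by have := mul_bin_diag (2 * n).+1 n; rewrite /=; nia.
Qed.

Lemma central_gfS n :
  central_gf n.+1 * n.+1%:R = (2 * (2 * n).+1)%:R * central_gf n.
Proof. by rewrite /central_gf -!natrM central_binS. Qed.

Lemma central_catalan n : central_gf n = n.+1%:R * C_gf n.
Proof.
rewrite /C_gf /central_gf mulrA mulrCA mulfV ?mulr1 ?mul1r //.
by rewrite pnatr_eq0.
Qed.

(** The recurrence [(n+1) b_(n+1) = 2 (2n+1) b_n] for the central binomial
    coefficients, written as a differential equation. *)
Lemma theta_central :
  (1 - fpsX *+ 4) * fps_theta central_gf = (fpsX * central_gf) *+ 2.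
Proof.
rewrite mulrBl mul1r mulrnAl; apply: boolp.funext => -[|n].
  by rewrite fps_addE fps_oppE !fps_mulrnE !fps_mulX0 /fps_theta !mul0rn subr0.
rewrite fps_addE fps_oppE !fps_mulrnE !fps_mulXS /fps_theta.
rewrite -[_ *+ n.+1]mulr_natr central_gfS.
by rewrite -[_ *+ n]mulr_natl; ring.
Qed.

Lemma theta_eq0 (f : fps rat) : fps_theta f = 0 -> forall n, f n.+1 = 0.
Proof.
move=> f0 n; apply/eqP; have /eqP : fps_theta f n.+1 = 0 by rewrite f0.
by rewrite /fps_theta mulrn_eq0.
Qed.

(** By the differential equation for [B], the product [B^2 (1 - 4x)] has zero
    derivative, hence equals its constant term. *)
Lemma central_sqr : central_gf ^+ 2 * (1 - fpsX *+ 4) = 1.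
Proof.
pose f := central_gf ^+ 2 * (1 - fpsX *+ 4); rewrite -/f.
have f0 : fps_theta f = 0.
  have thx : fps_theta (1 - fpsX *+ 4) = - (fpsX *+ 4).
    apply: boolp.funext => n; rewrite /fps_theta !fps_addE !fps_oppE !fps_mulrnE.
    rewrite fps_oneE /fps_X; case: n => [|[|n]] //=.
    by rewrite !mul0rn oppr0.
  rewrite /f expr2 !fps_thetaM thx.
  have := theta_central; set t := fps_theta _; set B := central_gf => E.
  transitivity (B * (((1 - fpsX *+ 4) * t) *+ 2 - (fpsX * B) *+ 4)); first by ring.
  by rewrite E; ring.
apply: boolp.funext => -[|n]; last by rewrite theta_eq0.
rewrite /f fps_mulE big_ord1 expr2 fps_mulE big_ord1 /central_gf.
by rewrite fps_addE fps_oppE fps_mulrnE.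
Qed.

Lemma central_sqrE n : (central_gf ^+ 2) n = 4%:R ^+ n.
Proof.
pose g : fps rat := fun n => 4%:R ^+ n.
suff -> : central_gf ^+ 2 = g by [].
have Eg : g * (1 - fpsX *+ 4) = 1.
  rewrite mulrBr mulr1 mulrnAr mulrC; apply: boolp.funext => -[|k].
    by rewrite fps_addE fps_oppE fps_mulrnE fps_mulX0.
  rewrite fps_addE fps_oppE fps_mulrnE fps_mulXS /g fps_oneE exprS -[X in _ - X]mulr_natl.
  by rewrite subrr.
by rewrite -[LHS]mulr1 -Eg mulrCA central_sqr mulr1.
Qed.

(** The left-hand side is the square root of [1 - 4x]; the identity is the usual
    closed form of the Catalan series, cleared of denominators. *)
Lemma sqrt_catalan : central_gf * (1 - fpsX *+ 4) = 1 - (fpsX * C_gf) *+ 2.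
Proof.
rewrite mulrBr mulr1 mulrnAr mulrC; apply: boolp.funext => -[|n].
  by rewrite !fps_addE !fps_oppE !fps_mulrnE !fps_mulX0.
rewrite !fps_addE !fps_oppE !fps_mulrnE !fps_mulXS fps_oneE /= add0r.
have n0 : n.+1%:R != 0 :> rat by rewrite pnatr_eq0.
apply: (mulfI n0); rewrite mulrBr [n.+1%:R * _]mulrC central_gfS.
by rewrite mulrN -[_ *+ 2]mulr_natl [X in _ = - X]mulrCA -central_catalan; ring.
Qed.

(** Squaring [1 - 2xC], the square root of [1 - 4x], gives the quadratic equation
    multiplied by [4x]. *)
Lemma catalan_fun_eq : C_gf = 1 + fpsX * C_gf ^+ 2.
Proof.
have E : (1 - (fpsX * C_gf) *+ 2) ^+ 2 = 1 - fpsX *+ 4.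
  by rewrite -sqrt_catalan exprMn [(1 - _) ^+ 2]expr2 mulrA central_sqr mul1r.
have E4 : (fpsX * (1 + fpsX * C_gf ^+ 2 - C_gf)) *+ 4 = 0.
  transitivity ((1 - (fpsX * C_gf) *+ 2) ^+ 2 - (1 - fpsX *+ 4)); first by ring.
  by rewrite E subrr.
apply/eqP; rewrite eq_sym -subr_eq0; apply/eqP.
apply: fps_mulX_inj; rewrite mulr0; apply: boolp.funext => n; apply/eqP.
have /eqP : ((fpsX * (1 + fpsX * C_gf ^+ 2 - C_gf)) *+ 4) n = 0 by rewrite E4.
by rewrite fps_mulrnE mulrn_eq0.
Qed.

Lemma central_catalan_inv : central_gf * (1 - (fpsX * C_gf) *+ 2) = 1.
Proof. by rewrite -sqrt_catalan mulrA -expr2 central_sqr. Qed.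

(** Multiply [B (1 - 2xC) = 1] by [C] and replace [x C^2] by [C - 1]. *)
Lemma central_mul_catalan : central_gf * C_gf = central_gf *+ 2 - C_gf.
Proof.
have E := catalan_fun_eq; have I := central_catalan_inv.
set B := central_gf in I *; set C := C_gf in E I *.
have <- : B *+ 2 - C * (B * (1 - (fpsX * C) *+ 2)) = B *+ 2 - C by rewrite I mulr1.
transitivity (B *+ 2 - (B * (C - (fpsX * C ^+ 2) *+ 2))); last by ring.
have -> : fpsX * C ^+ 2 = C - 1 by rewrite [in RHS]E; ring.
by ring.
Qed.

(** * Powers of the Catalan series *)

(** The coefficient of [x^(j+1)] in [(C - 1)^m].  In this form the recurrence below
    is linear in binomial coefficients, with no division. *)
Definition ballot_num (m j : nat) : rat :=
  'C((2 * j).+1, j + m)%:R - 'C((2 * j).+1, (j + m).+1)%:R.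

Lemma ballot_numS m j :
  ballot_num m.+1 j.+1 = ballot_num m j + ballot_num m.+1 j *+ 2 + ballot_num m.+2 j.
Proof.
rewrite /ballot_num.
have -> : ((2 * j.+1).+1 = (2 * j).+3)%N by lia.
have -> : (j.+1 + m.+1 = (j + m).+2)%N by lia.
rewrite !addnS !binS !natrD; ring.
Qed.

Lemma catalan_sub1_exp0 m : ((C_gf - 1) ^+ m.+1) 0%N = 0.
Proof.
rewrite exprS fps_mulE big_ord1 fps_addE fps_oppE fps_oneE /C_gf /=.
by rewrite bin0 divr1 mulr1 subrr mul0r.
Qed.

(** Induction on [j], for all [m] at once, from the identity
    [Z^(m+1) = x (Z^m + 2 Z^(m+1) + Z^(m+2))] for [Z = C - 1]. *)
Lemma catalan_sub1_expS m j : ((C_gf - 1) ^+ m) j.+1 = ballot_num m j.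
Proof.
have E : C_gf - 1 = fpsX * (1 + (C_gf - 1)) ^+ 2.
  by rewrite [in LHS]catalan_fun_eq; ring.
set Z := C_gf - 1 in E *.
have step k i : (Z ^+ k.+1) i.+1 = (Z ^+ k) i + (Z ^+ k.+1) i *+ 2 + (Z ^+ k.+2) i.
  have Ek : Z ^+ k.+1 = fpsX * (Z ^+ k + Z ^+ k.+1 *+ 2 + Z ^+ k.+2).
    by rewrite exprS {1}E !exprS; ring.
  by rewrite [in LHS]Ek fps_mulXS !fps_addE fps_mulrnE.
elim: j m => [|j IH] [|m].
- by [].
- rewrite step !catalan_sub1_exp0 mul0rn !addr0 /ballot_num.
  by case: m => [|m] //; rewrite catalan_sub1_exp0 !bin_small.
- rewrite expr0 fps_oneE /ballot_num addn0 -bin_sub; last by lia.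
  by rewrite [((2 * j.+1).+1 - _)%N](_ : _ = j.+2) ?subrr //; lia.
by rewrite step !IH ballot_numS.
Qed.

(** The two binomial coefficients are consecutive, with ratio
    [(j+1-m) / (j+1+m)]. *)
Lemma ballot_num_closed m j : (0 < m)%N -> (m <= j.+1)%N ->
  ballot_num m j = m%:R / (j.+1 + m)%:R * 'C((2 * j).+1, j.+1 - m)%:R *+ 2.
Proof.
move=> m0 mj; rewrite /ballot_num -[in RHS]bin_sub; last by lia.
rewrite [((2 * j).+1 - _)%N](_ : _ = (j + m)%N); last by lia.
have := mul_bin_left (2 * j).+1 (j + m).
rewrite [((2 * j).+1 - _)%N](_ : _ = (j.+1 - m)%N); last by lia.
move: 'C(_, _) 'C(_, _) => b a /(congr1 (fun k => k%:R : rat)).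
rewrite !natrM natrB // addSn => E.
have n0 : (j + m).+1%:R != 0 :> rat by rewrite pnatr_eq0.
apply: (mulfI n0).
rewrite mulrBr E.
transitivity (m%:R * (((j + m).+1%:R * (j + m).+1%:R^-1) * (b%:R *+ 2)) : rat);
  last by ring.
by rewrite mulfV // -addnS natrD; ring.
Qed.

Lemma catalan_sub1_exp_low m i : (i < m)%N -> ((C_gf - 1) ^+ m) i = 0.
Proof.
case: i m => [|i] [|m] // im; first exact: catalan_sub1_exp0.
by rewrite catalan_sub1_expS /ballot_num !bin_small ?subrr //; lia.
Qed.

(** * Generating functions of rectangles *)

Lemma size_catalan_words n : (size (catalan_words n))%:R = C_gf n.
Proof.
pose K : fps rat := fun n => (size (catalan_words n))%:R.
suff -> : C_gf = K by [].
apply: fps_catalan_unique; first exact: catalan_fun_eq.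
apply: boolp.funext => -[|k].
  by rewrite fps_addE fps_mulX0 addr0 /K catalan_words0.
rewrite fps_addE fps_mulXS fps_oneE add0r /K size_catalan_wordsS natr_sum.
by rewrite expr2 fps_mulE; apply: eq_bigr => i _; rewrite natrM.
Qed.

Lemma dt_P_gf s : (fps_eval_t (fps_dt (P_gf s)) 1 : fps rat) = h_gf 1 s.
Proof.
apply: boolp.funext => n; rewrite /fps_eval_t /fps_dt /P_gf /p_poly /h_gf /total_occ.
rewrite raddf_sum horner_sum natr_sum; apply: eq_bigr => w _.
by rewrite /= derivXn hornerMn hornerXn expr1n.
Qed.

Lemma h_gf_arch r s : (0 < r)%N -> (0 < s)%N ->
  (h_gf r.+1 s : fps rat) = fpsX * (h_gf r s * C_gf + C_gf * h_gf r.+1 s).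
Proof.
move=> r0 s0; apply: boolp.funext => -[|n].
  by rewrite fps_mulX0 /h_gf total_occ0.
rewrite fps_mulXS fps_addE !fps_mulE -big_split /h_gf total_occS // natr_sum.
by apply: eq_bigr => i _; rewrite natrD !natrM !size_catalan_words.
Qed.

(** Multiplying the arch equation by [C] cancels the factor [1 - xC], whose
    inverse is [C]. *)
Lemma h_gfS r s : (0 < r)%N -> (0 < s)%N ->
  (h_gf r.+1 s : fps rat) = (C_gf - 1) * h_gf r s.
Proof.
move=> r0 s0; have E := catalan_fun_eq; have H := h_gf_arch _ _ r0 s0.
set C := C_gf in E H *; set h : fps rat := h_gf r s in H *.
set h' : fps rat := h_gf r.+1 s in H *.
have Zx : C - 1 = fpsX * C ^+ 2 by rewrite {1}E; ring.
transitivity (C * h' - (C - 1) * h'); first by ring.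
by rewrite {1}H Zx; ring.
Qed.

Lemma h_gf_exp r s : (0 < s)%N ->
  (h_gf r.+1 s : fps rat) = h_gf 1 s * (C_gf - 1) ^+ r.
Proof.
move=> s0; elim: r => [|r IH]; first by rewrite mulr1.
by rewrite h_gfS // IH exprS mulrCA.
Qed.

(** The error made when the truncated number of windows [(n+1-s)^+] is replaced by
    the integer [n+1-s]. *)
Definition short_gf (s : nat) : fps rat := fun n => (s - 1 - n)%N%:R * C_gf n.

(** [H_1 (2 - C) = D], and [(2 - C) (1 + B) = 2] turns the division by [2 - C] into
    a multiplication. *)
Lemma h_gf1 s : (0 < s)%N ->
  (h_gf 1 s : fps rat) *+ 2 =
  central_gf ^+ 2 + central_gf + short_gf s * (1 + central_gf)
  - central_gf *+ (2 * s).
Proof.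
move=> s0.
have D : (h_gf 1 s : fps rat) =
    central_gf - C_gf *+ s + short_gf s + (C_gf - 1) * h_gf 1 s.
  rewrite -h_gfS //; apply: boolp.funext => n.
  rewrite !fps_addE fps_oppE fps_mulrnE central_catalan /short_gf /h_gf total_occ_row1 //.
  rewrite natrD natrM size_catalan_words; congr (_ + _).
  rewrite -[C_gf n *+ s]mulr_natl -mulrBl -mulrDl; congr (_ * _).
  case: (leqP s n.+1) => sn.
    by rewrite natrB // (_ : (s - 1 - n = 0)%N) ?addr0 //; lia.
  rewrite (_ : (n.+1 - s = 0)%N); last by lia.
  by rewrite (_ : (s - 1 - n = s - n.+1)%N) ?natrB ?(ltnW sn) //; [ring | lia].
have I := central_mul_catalan.
set B := central_gf in I D *; set C := C_gf in I D *; set h : fps rat := h_gf 1 s in D *.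
set S := short_gf s in D *.
have D' : h *+ 2 - C * h = B - C *+ s + S.
  by rewrite -[RHS](addrK ((C - 1) * h)) -D; ring.
transitivity ((h *+ 2 - C * h) + (h *+ 2 * B - (B * C) * h)).
  by rewrite I; ring.
transitivity ((h *+ 2 - C * h) * (1 + B)); first by ring.
rewrite D'.
transitivity (B ^+ 2 + B + S * (1 + B) - (C + B * C) *+ s).
  by rewrite -[C *+ s]mulr_natl -[(C + B * C) *+ s]mulr_natl; ring.
by rewrite I [C + _](_ : _ = B *+ 2) ?mulrnA //; ring.
Qed.

Lemma h_gf1_coef s n : (0 < s)%N -> (s <= n)%N ->
  h_gf 1 s n *+ 2 =
  \sum_(0 <= i < s - 1)
     (s - 1 - i)%N%:R / (i + 1)%N%:R * 'C(2 * i, i)%:R * 'C(2 * n - 2 * i, n - i)%:R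
  - (2 * s - 1)%N%:R * 'C(2 * n, n)%:R + 4%:R ^+ n :> rat.
Proof.
move=> s0 sn; rewrite -fps_mulrnE h_gf1 // !fps_addE fps_oppE fps_mulrnE.
rewrite central_sqrE mulrDr mulr1 fps_addE {1}/short_gf.
rewrite (_ : (s - 1 - n = 0)%N); last by lia.
rewrite mul0r add0r.
have -> : (short_gf s * central_gf) n = \sum_(0 <= i < s - 1)
     (s - 1 - i)%N%:R / (i + 1)%N%:R * 'C(2 * i, i)%:R * 'C(2 * n - 2 * i, n - i)%:R.
  rewrite fps_mulE -(big_mkord xpredT (fun i => short_gf s i * central_gf (n - i)%N)).
  rewrite (big_cat_nat (n := s - 1)) //=; last by lia.
  rewrite [X in _ + X]big_nat_cond [X in _ + X]big1 ?addr0; last first.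
    move=> i /andP[/andP[si _] _].
    by rewrite /short_gf (_ : (s - 1 - i = 0)%N) ?mul0r //; lia.
  apply: eq_bigr => i _; rewrite /short_gf /central_gf /C_gf addn1 mulnBr; ring.
rewrite -[_ *+ (2 * s)]mulr_natl natrB; last by lia.
rewrite /central_gf; ring.
Qed.

Lemma big_nat_support (a b c d : nat) (F : nat -> rat) :
  (c <= a)%N -> (b <= d)%N ->
  (forall k, (c <= k < d)%N -> ~~ (a <= k < b)%N -> F k = 0) ->
  \sum_(a <= k < b) F k = \sum_(c <= k < d) F k.
Proof.
move=> ca bd F0; rewrite (big_nat_widenl _ c) // (big_nat_widen _ _ d) //.
rewrite big_mkcond; apply: eq_big_nat => k kcd /=.
by case: ifPn => // nk; rewrite F0.
Qed.

Theorem theorem14 (r s : nat) (hr : (2 <= r)%N) (hs : (1 <= s)%N) :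
  (forall n : nat,
     h_gf r s n =
     fps_mul (fps_eval_t (fps_dt (P_gf s)) 1)
             (fps_exp (fps_sub C_gf fps_one) (r - 1)) n)
  /\
  (forall n : nat,
     (total_occ r s n)%:R =
     \sum_(r <= k < (n + 1 - s).+1)
       (r - 1)%N%:R / (k + r - 2)%N%:R * 'C(2 * k - 3, k - r)%:R *
       (\sum_(0 <= i < s - 1)
           (s - 1 - i)%N%:R / (i + 1)%N%:R * 'C(2 * i, i)%:R *
           'C(2 * (n + 1 - k) - 2 * i, n + 1 - k - i)%:R
        - (2 * s - 1)%N%:R * 'C(2 * (n + 1 - k), n + 1 - k)%:R
        + 4%:R ^+ (n + 1 - k)) :> rat).
Proof.
have Eh : (h_gf r s : fps rat) = h_gf 1 s * (C_gf - 1) ^+ (r - 1).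
  by rewrite -h_gf_exp // subn1 prednK // ltnW.
split=> n; first by rewrite dt_P_gf fps_expE Eh.
have -> : (total_occ r s n)%:R = (h_gf 1 s * (C_gf - 1) ^+ (r - 1)) n by rewrite -Eh.
(* The power of [C - 1] comes first, and its exponent of [x] is [k - 1]. *)
rewrite mulrC fps_mulE.
rewrite -(big_mkord xpredT (fun i => ((C_gf - 1) ^+ (r - 1)) i * h_gf 1 s (n - i)%N)).
rewrite -(big_add1 _ _ 0 n.+2 xpredT
  (fun k => ((C_gf - 1) ^+ (r - 1)) k.-1 * h_gf 1 s (n - k.-1)%N)).
rewrite -(@big_nat_support r (n + 1 - s).+1); first last.
- move=> k /andP[k1 kn]; rewrite negb_and -ltnNge -leqNgt => /orP[kr|kns].
    by rewrite catalan_sub1_exp_low ?mul0r //; lia.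
  by rewrite /h_gf total_occ_small ?mulr0 //; lia.
- by lia.
- by lia.
apply: eq_big_nat => k /andP[rk kns].
rewrite -h_gf1_coef //; last by lia.
have [j Ek] : exists j, k = j.+2 by exists (k - 2)%N; lia.
rewrite Ek /= catalan_sub1_expS ballot_num_closed; [|lia|lia].
rewrite (_ : (n - j.+1 = n + 1 - j.+2)%N); last by lia.
rewrite (_ : (j.+1 + (r - 1) = j.+2 + r - 2)%N); last by lia.
rewrite (_ : (2 * j.+2 - 3 = (2 * j).+1)%N); last by lia.
rewrite (_ : (j.+2 - r = j.+1 - (r - 1))%N); last by lia.
by rewrite [RHS]mulrnAr [LHS]mulrnAl.
Qed.
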